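(* Let $t$ be a positive integer and let $\Omega\subseteq\mathbb{C}$ be a neighborhood of the origin. Then there is no transcendental function $f(z)=\sum_{k\geq 0}a_kz^k\in\mathbb{C}[[z]]$, analytic in $\Omega$, such that all of the following hold: (i) $a_k\in\mathbb{Q}$ for all integers $k$ with $0\le k\le t$; (ii) $f(\mathbb{Q}\cap\Omega)\subseteq\mathbb{Q}$; (iii) $\operatorname{den} f(p/q)=O(q^{t/2})$ for all rational numbers $p/q\in\Omega$ with $q$ sufficiently large, i.e. there exist constants $C>0$ and $q_0$ such that $\operatorname{den} f(p/q)\le C\,q^{t/2}$ for every rational number $p/q\in\Omega$ written in lowest terms with $q\ge q_0$.
   Context: For a rational number $z$, $\operatorname{den}(z)$ denotes the (positive) denominator of $z$ written as an irreducible fraction. A rational number $p/q$ is understood to be written in lowest terms with $q\geq 1$. A function is transcendental if it is not algebraic over $\mathbb{C}(z)$; in particular, a transcendental function is not a rational function. *)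

(* Defs.v *)
From HB Require Import structures.
From mathcomp Require Import all_boot all_order all_algebra.
From mathcomp Require Import complex.
From mathcomp Require Import all_classical all_reals all_analysis.

Set Implicit Arguments.
Unset Strict Implicit.
Unset Printing Implicit Defensive.

Import Order.TTheory GRing.Theory Num.Theory.
Import numFieldNormedType.Exports.

Local Open Scope classical_set_scope.
Local Open Scope ring_scope.

(* Stated over an arbitrary [numFieldType], because that is the level at which
   the topology of the norm is found by unification; the intended instance is
   [K := R[i]] with [R : realType], whose norm is the complex modulus. *)

Definition has_power_series (K : numFieldType) (f : K -> K) (z0 : K)
    (c : nat -> K) : Prop :=
  \forall z \near z0,
    series (fun k : nat => c k * (z - z0) ^+ k) @ \oo --> f z.

Definition analytic_at (K : numFieldType) (f : K -> K) (z0 : K) : Prop :=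
  exists c : nat -> K, has_power_series f z0 c.

Definition analytic_on (K : numFieldType) (Omega : set K) (f : K -> K) : Prop :=
  forall z0 : K, Omega z0 -> analytic_at f z0.

(* Denominators cleared, a polynomial equation over K(z) is given by a nonzero
   [P : {poly {poly K}}], whose outer variable stands for the value of the
   function and whose inner variable is [z].  It is required to hold on a
   neighborhood of the origin, so that it is an equation for the power series
   at 0: if a domain of analyticity is not connected, its components away from
   the origin are irrelevant; if it is connected, the equation then holds on all
   of it. *)
Definition algebraic (K : numFieldType) (f : K -> K) : Prop :=
  exists2 P : {poly {poly K}}, P != 0 &
    \forall z \near (0 : K), P.[(f z)%:P].[z] = 0.

Definition transcendental (K : numFieldType) (f : K -> K) : Prop :=
  ~ algebraic f.

Definition rationals (K : numFieldType) : set K := range (@ratr K).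
Arguments rationals K : clear implicits.

(* Main.v *)
Require Import Defs.
From HB Require Import structures.
From mathcomp Require Import all_boot all_order all_algebra.
From mathcomp Require Import complex.
From mathcomp Require Import all_classical all_reals all_analysis.
From mathcomp Require Import ring zify.

(** Let [A f - B = O(z ^ (t + 1))] with [A != 0] be a Pade approximation of [f]
    of type [(ceil (t / 2), floor (t / 2))]; it has rational coefficients because
    [a_0, ..., a_t] are rational.  At [z = 1 / q] the rational number
    [A f - B] is [O(q ^ - (t + 1))], while (iii) bounds its denominator by
    [O(q ^ (ceil (t / 2) + t / 2)) = O(q ^ (t + 1 / 2))], so it vanishes for
    all large [q].  The zeros [1 / q] accumulate at the origin, hence
    [A f = B] near the origin and [f] is algebraic. *)

Set Implicit Arguments.
Unset Strict Implicit.
Unset Printing Implicit Defensive.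

Import Order.TTheory GRing.Theory Num.Theory.
Import numFieldNormedType.Exports.

Local Open Scope classical_set_scope.
Local Open Scope ring_scope.

(** * Expansions at the origin: sums, shifts and products with polynomials *)

Lemma has_power_series_cst (K : numFieldType) (x : K) :
  has_power_series (fun=> x) 0 (fun k => x *+ (k == 0%N)).
Proof.
apply: filterE => z; rewrite -cvg_shiftS.
apply: cvg_trans (cvg_cst (F := \oo) x); apply: near_eq_cvg; apply: nearW => n.
rewrite /series /= big_nat_recl//= expr0 mulr1 mulr1n big1 ?addr0//.
by move=> i _; rewrite mulr0n mul0r.
Qed.

Lemma has_power_seriesD (K : numFieldType) (f g : K -> K) (a b : nat -> K) :
  has_power_series f 0 a -> has_power_series g 0 b ->
  has_power_series (fun z => f z + g z) 0 (fun k => a k + b k).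
Proof.
move=> fa gb; rewrite /has_power_series; near=> z.
have fz : series (fun k => a k * (z - 0) ^+ k) @ \oo --> f z by near: z.
have gz : series (fun k => b k * (z - 0) ^+ k) @ \oo --> g z by near: z.
apply: cvg_trans (cvgD fz gz); apply: near_eq_cvg; apply: nearW => n.
rewrite /= /series /=; under [RHS]eq_bigr do rewrite mulrDl.
by rewrite big_split.
Unshelve. all: by end_near. Qed.

Lemma has_power_seriesZ (K : numFieldType) (x : K) (f : K -> K) (a : nat -> K) :
  has_power_series f 0 a ->
  has_power_series (fun z => x * f z) 0 (fun k => x * a k).
Proof.
apply: filterS => z fz.
apply: cvg_trans (cvgMl_tmp (a := x) fz); apply: near_eq_cvg; apply: nearW => n.
by rewrite /= /series /= mulr_sumr; apply: eq_bigr => k _; rewrite mulrA.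
Qed.

Lemma has_power_seriesX (K : numFieldType) (f : K -> K) (a : nat -> K) :
  has_power_series f 0 a ->
  has_power_series (fun z => z * f z) 0
    (fun k => if k is k'.+1 then a k' else 0).
Proof.
apply: filterS => z fz; rewrite -cvg_shiftS.
apply: cvg_trans (cvgMl_tmp (a := z) fz); apply: near_eq_cvg; apply: nearW => n.
rewrite /= /series /= mulr_sumr big_nat_recl//= mul0r add0r.
by apply: eq_bigr => k _; rewrite exprS mulrCA subr0.
Qed.

(** Since one factor is a polynomial, Horner's scheme [p * 'X + c] yields the Cauchy product from a
    shift, a scaling and a sum, with no appeal to absolute convergence. *)
Lemma has_power_series_polyM (K : numFieldType) (p : {poly K}) (f : K -> K)
    (a : nat -> K) :
  has_power_series f 0 a ->
  has_power_series (fun z => p.[z] * f z) 0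
    (fun k => \sum_(j < k.+1) p`_j * a (k - j)%N).
Proof.
move=> fa; elim/poly_ind: p => [|p c IHp].
  under [X in has_power_series X]eq_fun do rewrite horner0 -(horner0 0).
  have := has_power_seriesZ 0 fa; congr has_power_series; apply/funext => k.
    by rewrite horner0.
  by rewrite big1 ?mul0r// => j _; rewrite coef0 mul0r.
have := has_power_seriesD (has_power_seriesX IHp) (has_power_seriesZ c fa).
congr has_power_series; apply/funext => k.
  by rewrite hornerMXaddC; ring.
rewrite big_ord_recl coefD coefMX coefC /= add0r subn0 addrC; congr (_ + _).
case: k => [|k]; first by rewrite big_ord0.
by apply: eq_bigr => j _; rewrite coefD coefMX coefC /= addr0.
Qed.

Lemma has_power_series_poly (K : numFieldType) (p : {poly K}) :
  has_power_series (fun z => p.[z]) 0 (fun k => p`_k).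
Proof.
have := has_power_series_polyM p (has_power_series_cst 1).
congr has_power_series; apply/funext => k; first by rewrite mulr1.
rewrite big_ord_recr /= subnn mulr1 big1 ?add0r// => j _.
by rewrite subn_eq0 leqNgt ltn_ord mulr0.
Qed.

Lemma has_power_series_polyMB (K : numFieldType) (A B : {poly K}) (f : K -> K)
    (a : nat -> K) :
  has_power_series f 0 a ->
  has_power_series (fun z => A.[z] * f z - B.[z]) 0
    (fun k => \sum_(j < k.+1) A`_j * a (k - j)%N - B`_k).
Proof.
move=> fa; have := has_power_seriesD (has_power_series_polyM A fa)
  (has_power_series_poly (- B)).
by congr has_power_series; apply/funext => z; rewrite ?hornerN ?coefN.
Qed.

(** * Order of vanishing and the identity theorem *)

Lemma has_power_series_coef_bounded (K : numFieldType) (g : K -> K)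
    (c : nat -> K) :
  has_power_series g 0 c ->
  exists (M rho : K), [/\ 0 < M, 0 < rho & forall k, `|c k| * rho ^+ k <= M].
Proof.
move=> /nbhs_ballP[e /= e0 eg].
have e20 : 0 < e / 2 by rewrite divr_gt0.
(* The series converges at the nonzero point [e / 2], so its terms there tend to 0 and are bounded;
   this point serves as [rho]. *)
have /eg /= gr : ball (0 : K) e (e / 2).
  by rewrite /ball /= sub0r normrN gtr0_norm// ltr_pdivrMr// mulr2n mulrDr mulr1 ltrDl.
have /cvg_series_cvg_0 c0 : cvgn (series (fun k => c k * (e / 2 - 0) ^+ k)).
  by apply/cvg_ex; exists (g (e / 2)).
have /cvg_seq_bounded : cvgn (fun k => c k * (e / 2 - 0) ^+ k).
  by apply/cvg_ex; exists 0.
move=> /ex_bound[|M Mb]; first exact: (globally_properfilter (a := 0%N)).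
have Mb' k : `|c k| * (e / 2) ^+ k <= M.
  have := Mb k I; rewrite /= subr0 normrM normrX [`|e / 2|]gtr0_norm//.
exists (M + 1), (e / 2); split => //.
  by rewrite ltr_pwDr// (le_trans _ (Mb' 0%N))// mulr_ge0// exprn_ge0// ltW.
by move=> k; rewrite (le_trans (Mb' k))// lerDl.
Qed.

Lemma has_power_series_order (K : numFieldType) (g : K -> K) (c : nat -> K)
    (N : nat) :
  has_power_series g 0 c -> (forall k, (k < N)%N -> c k = 0) ->
  exists2 M : K, 0 < M & \forall z \near 0^', `|g z| <= M * `|z| ^+ N.
Proof.
move=> gc c0; have [M [rho [M0 rho0 cM]]] := has_power_series_coef_bounded gc.
(* The first summand bounds every partial sum, as a geometric series of ratio at most 1/2; the [+ 1]
   absorbs the distance from a partial sum to [g z]. *)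
exists (2 * M / rho ^+ N + 1); first by rewrite addr_gt0// divr_gt0// ?exprn_gt0// mulr_gt0.
near=> z.
have z0 : z != 0 by near: z; exact: nbhs_dnbhs_neq.
have gz : series (fun k => c k * (z - 0) ^+ k) @ \oo --> g z.
  by near: z; apply: nbhs_dnbhs.
set x := `|z| / rho.
have x0 : 0 <= x by rewrite divr_ge0// ltW.
have x2 : x <= 2^-1.
  rewrite ler_pdivrMr//; apply: ltW; near: z.
  apply: (@nbhs_dnbhs K (0 : K)); apply: (@nbhs0_lt K K).
  by rewrite mulr_gt0// invr_gt0.
(* The subtracted [x ^+ (N + m)] lets the induction close: as [x <= 1 / 2], the next term is at most
   [2 * M * (x ^+ (N + m) - x ^+ (N + m).+1)]. *)
have bnd m : `|series (fun k => c k * (z - 0) ^+ k) (N + m)%N|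
    <= 2 * M * (x ^+ N - x ^+ (N + m)).
  elim: m => [|m IHm].
    rewrite addn0 subrr mulr0 /series /= big_mkord big1 ?normr0// => i _.
    by rewrite c0// mul0r.
  have xS : x ^+ (N + m).+1 <= x ^+ (N + m) / 2.
    by rewrite exprSr ler_wpM2l// exprn_ge0.
  have cS : `|c (N + m)%N * (z - 0) ^+ (N + m)| <= M * x ^+ (N + m).
    rewrite subr0 normrM normrX -(divfK (lt0r_neq0 rho0) `|z|) -/x mulrC.
    by rewrite exprMn -mulrA mulrC ler_wpM2r ?exprn_ge0// mulrC.
  rewrite addnS seriesSr (le_trans (ler_normD _ _))//.
  rewrite (le_trans (lerD IHm cS))//.
  have -> : 2 * M * (x ^+ N - x ^+ (N + m)) + M * x ^+ (N + m) =
      2 * M * (x ^+ N - x ^+ (N + m) / 2) by field.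
  by apply: ler_wpM2l; [rewrite mulr_ge0// ltW|rewrite lerD2l lerN2].
have zN0 : 0 < `|z| ^+ N by rewrite exprn_gt0// normr_gt0.
have /cvgrPdist_lt/(_ _ zN0) gzn := gz; near \oo => n.
have Nn : (N <= n)%N by near: n; exact: nbhs_infty_ge.
have gzn' : `|g z - series (fun k => c k * (z - 0) ^+ k) n| < `|z| ^+ N.
  by near: n; exact: gzn.
rewrite -(subrK (series (fun k => c k * (z - 0) ^+ k) n) (g z)).
rewrite (le_trans (ler_normD _ _))// mulrDl mul1r addrC; apply: lerD; last exact: ltW.
have := bnd (n - N)%N; rewrite subnKC// => /le_trans; apply.
rewrite -(mulrA (2 * M)); apply: ler_wpM2l; first by rewrite mulr_ge0// ltW.
by rewrite mulrC -expr_div_n -/x lerBlDr lerDl exprn_ge0.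
Unshelve. all: by end_near. Qed.

(** If the coefficients before [c N] vanish, then [g z - c N * z ^+ N] is [O(z ^ (N + 1))]. At a
    zero [u n] of [g] this gives [|c N| <= M * |u n|], which fails for large [n] unless
    [c N = 0]. *)
Lemma power_series_coef_eq0 (K : numFieldType) (g : K -> K) (c : nat -> K)
    (u : nat -> K) :
  has_power_series g 0 c -> u @ \oo --> 0^' ->
  (\forall n \near \oo, g (u n) = 0) -> forall k, c k = 0.
Proof.
move=> gc u0 gu; elim/ltn_ind => N IHN.
have := has_power_seriesD gc (has_power_series_poly (- (c N) *: 'X^N)).
set h := fun z => _ => hc.
have [k|M M0 hM] := has_power_series_order (N := N.+1) hc.
  rewrite ltnS leq_eqVlt => /predU1P[->|kN]; rewrite coefZ coefXn.
    by rewrite eqxx mulr1 subrr.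
  by rewrite IHN// ltn_eqF// mulr0 addr0.
apply/eqP; apply: contraT; rewrite -normr_gt0 => cN0.
have hu : \forall n \near \oo, `|h (u n)| <= M * `|u n| ^+ N.+1 by exact: (u0 _ hM).
have un0 : \forall n \near \oo, u n != 0.
  exact: (u0 _ (nbhs_dnbhs_neq (0 : K))).
have ulec : \forall n \near \oo, `|u n| < `|c N| / M.
  apply: (u0 [set z | `|z| < `|c N| / M]); apply: (@nbhs_dnbhs K (0 : K)).
  by apply: (@nbhs0_lt K K); rewrite divr_gt0.
near \oo => n.
have uN0 : 0 < `|u n| ^+ N by rewrite exprn_gt0// normr_gt0; near: n.
have : `|h (u n)| <= M * `|u n| ^+ N.+1 by near: n.
rewrite /h hornerZ hornerXn (_ : g (u n) = 0); last by near: n.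
rewrite add0r mulNr normrN normrM normrX exprS mulrA ler_pM2r//.
have /lt_geF -> // : M * `|u n| < `|c N|.
by rewrite mulrC -ltr_pdivlMr//; near: n.
Unshelve. all: by end_near. Qed.

Lemma power_series_eq0 (K : numFieldType) (g : K -> K) (c : nat -> K) :
  has_power_series g 0 c -> (forall k, c k = 0) -> \forall z \near 0, g z = 0.
Proof.
move=> gc c0; near=> z.
have gz : series (fun k => c k * (z - 0) ^+ k) @ \oo --> g z by near: z.
have cz0 : series (fun k => c k * (z - 0) ^+ k) = fun=> 0.
  by apply/funext => n; rewrite /series /= big1// => k _; rewrite c0 mul0r.
by move: gz; rewrite cz0 => /(cvg_lim (@norm_hausdorff _ K)) <-; exact: lim_cst.
Unshelve. all: by end_near. Qed.

(** * Pade approximation and integrality at the points [1 / q] *)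

Lemma pade_approximant (F : fieldType) (a : {poly F}) (m n : nat) :
  exists A B : {poly F}, [/\ A != 0, (size A <= m.+1)%N, (size B <= n.+1)%N &
    forall k, (k <= m + n)%N -> (A * a - B)`_k = 0].
Proof.
(* The unknowns are the [m + 1] coefficients of [A]; the [m] equations kill the coefficients of
   [A * a] in degrees [n + 1] to [n + m]. With more rows than columns, [M] has a nonzero left kernel
   vector. Then [B] is [A * a] truncated to degree [n]. *)
pose M := \matrix_(j < m.+1, i < m) ('X^j * a)`_(n.+1 + i).
have /rowV0Pn[u /sub_kermxP uM u0] : kermx M != 0.
  by rewrite kermx_eq0 /row_free neq_ltn ltnS rank_leq_col.
pose A := rVpoly u; exists A, (take_poly n.+1 (A * a)); split.
- by apply: contra_neq u0 => A0; rewrite -[u]rVpolyK -/A A0 linear0.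
- exact: size_poly.
- exact: size_take_poly.
move=> k kmn; rewrite coefB coef_take_poly; case: ltnP => [|nk].
  by rewrite subrr.
have km : (k - n.+1 < m)%N by lia.
have /matrixP/(_ 0 (Ordinal km)) := uM; rewrite !mxE /= subr0; apply: etrans.
have -> : A = \sum_(j < m.+1) u 0 j *: 'X^j.
  by rewrite /A {1}/rVpoly poly_def; apply: eq_bigr => j _; rewrite valK.
rewrite mulr_suml coef_sum.
by apply: eq_bigr => j _; rewrite !mxE /= subnKC// -scalerAl coefZ.
Qed.

(** [D] is a common denominator of the coefficients of [p], and [q ^ n] clears the powers of
    [1 / q], the degree being at most [n]. *)
Lemma clear_denominators (p : {poly rat}) (n : nat) : (size p <= n.+1)%N ->
  exists2 D : nat, (0 < D)%N & forall q : nat, (0 < q)%N ->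
    (D * q ^ n)%:R * p.[q%:R^-1] \is a Num.int.
Proof.
have [r [d d0 ->]] := rat_poly_scale p; rewrite size_scale; last first.
  by rewrite invr_eq0 intr_eq0.
move=> rn; exists `|d|%N; rewrite ?absz_gt0// => q q0.
rewrite hornerZ (horner_coef_wide _ rn) natrM mulrACA natrX natr_absz.
rewrite rpredM//.
  by rewrite intr_norm normrEsign mulfK ?intr_eq0// rpred_sign.
rewrite mulr_sumr rpred_sum// => i _; rewrite coef_map /=.
rewrite mulrCA rpredM ?intr_int// exprVn -expfB_cond; last first.
  by rewrite pnatr_eq0 gtn_eqF// leq_ord.
by rewrite rpredX// rpred_nat.
Qed.
(** Here [s] stands for [f (1 / q)]. Multiplying the difference by [D1 * D2 * q ^ n * denq s] gives
    an integer of size [O(q ^ (n - t / 2 - 1))]. Since [2 n <= t + 1], the exponent is at most -1/2,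
    so the integer is 0 beyond a threshold independent of [s]. *)
Lemma pade_values_eq (R : realType) (t n : nat) (A B : {poly rat}) (M C : R) :
  (n.*2 <= t.+1)%N -> (size A <= n.+1)%N -> (size B <= n.+1)%N ->
  exists q1 : nat, forall (q : nat) (s : rat), (q1 < q)%N ->
    (denq s)%:~R <= C * q%:R `^ (t%:R / 2) ->
    ratr `|A.[q%:R^-1] * s - B.[q%:R^-1]| <= M * q%:R^-1 ^+ t.+1 ->
    A.[q%:R^-1] * s = B.[q%:R^-1].
Proof.
move=> nt sA sB; have [D1 D1_gt0 D1A] := clear_denominators sA.
have [D2 D2_gt0 D2B] := clear_denominators sB.
(* The final inequality is squared so that the real power [q ^ (t / 2)] becomes the natural power
   [q ^ t]; [E] is the square of its constant. *)
pose E : R := ((D1 * D2)%:R * C * M) ^+ 2.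
exists (Num.bound E) => q s q1q sC yM; apply/eqP; rewrite -subr_eq0.
set y := _ - _ in yM *; apply: contraT => y0.
have q0 : (0 < q)%N by apply: leq_ltn_trans q1q.
have qR0 : 0 < q%:R :> R by rewrite ltr0n.
have yint : (D1 * D2 * q ^ n)%:R * (denq s)%:~R * y \is a Num.int.
  have -> : (D1 * D2 * q ^ n)%:R * (denq s)%:~R * y =
      D2%:R * ((D1 * q ^ n)%:R * A.[q%:R^-1]) * (s * (denq s)%:~R)
      - D1%:R * (denq s)%:~R * ((D2 * q ^ n)%:R * B.[q%:R^-1]).
    by rewrite /y !natrM; ring.
  have iA := D1A _ q0; have iB := D2B _ q0.
  by rewrite -numqE rpredB// rpredM ?intr_int// rpredM// ?rpred_nat ?intr_int.
have y1 : 1 <= (D1 * D2 * q ^ n)%:R * (denq s)%:~R * `|y|.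
  rewrite -[X in X * _](@ger0_norm rat) ?mulr_ge0 ?ler0n ?ler0z ?denq_ge0//.
  rewrite -normrM norm_intr_ge1// mulf_neq0// mulf_neq0 ?intr_eq0 ?denq_neq0//.
  by rewrite pnatr_eq0 -lt0n !muln_gt0 D1_gt0 D2_gt0 expn_gt0 q0.
have {}y1 : 1 <= (D1 * D2 * q ^ n)%:R * (denq s)%:~R * ratr `|y| :> R.
  by move: y1; rewrite -(ler_rat R) rmorph1 !rmorphM /= !ratr_nat ratr_int.
set P := q%:R `^ _ in sC.
have P2 : P ^+ 2 = q%:R ^+ t.
  by rewrite -powR_mulrn ?powR_ge0// -powRrM divfK// powR_mulrn.
have bound1 : q%:R ^+ t.+1 <= (D1 * D2)%:R * C * M * (q%:R ^+ n * P).
  have Z : 0 <= (D1 * D2 * q ^ n)%:R :> R by [].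
  have s0 : 0 <= (denq s)%:~R :> R by rewrite ler0z denq_ge0.
  have : 1 <= (D1 * D2 * q ^ n)%:R * (C * P) * (M * q%:R^-1 ^+ t.+1).
    rewrite (le_trans y1)// ler_pM//; [exact: mulr_ge0|by rewrite ler0q|].
    by rewrite ler_wpM2l.
  rewrite exprVn mulrA ler_pdivlMr ?exprn_gt0// mul1r => /le_trans; apply.
  by rewrite le_eqVlt !natrM natrX; apply/orP; left; apply/eqP; ring.
(* Here [2 n + t <= 2 t + 1]; cancelling [q ^ (2 t + 1)] leaves [q <= E], against the choice of the
   threshold. *)
have bound2 : q%:R ^+ (t.+1).*2 <= E * q%:R ^+ t.*2.+1.
  have : q%:R ^+ (t.+1).*2 <= E * q%:R ^+ (n.*2 + t).
    have -> : E * q%:R ^+ (n.*2 + t) =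
        ((D1 * D2)%:R * C * M * (q%:R ^+ n * P)) ^+ 2.
      by rewrite exprD -muln2 exprM -P2 /E !exprMn; ring.
    rewrite -muln2 exprM ler_pXn2r// nnegrE ?exprn_ge0//.
    by rewrite (le_trans _ bound1)// exprn_ge0.
  move=> /le_trans; apply; rewrite ler_wpM2l ?sqr_ge0// ler_weXn2l ?ler1n//.
  by lia.
have := archi_boundP (sqr_ge0 _ : 0 <= E).
move: bound2; rewrite doubleS exprS ler_pM2r ?exprn_gt0// => qE /(le_lt_trans qE).
by rewrite ltr_nat ltnNge (ltnW q1q).
Qed.

(** * From zeros at the points [1 / q] to algebraicity *)

Lemma rational_algebraic (K : numFieldType) (f : K -> K) (A B : {poly K}) :
  A != 0 -> (\forall z \near 0, A.[z] * f z - B.[z] = 0) -> algebraic f.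
Proof.
move=> A0 AB; exists (A%:P * 'X - B%:P); last first.
  by apply: filterS AB => z; rewrite !hornerE.
apply: contra_neq A0 => P0; have : (A%:P * 'X - B%:P)`_1 = 0 by rewrite P0 coef0.
by rewrite coefB coefMX !coefC /= subr0.
Qed.

(** A positive element of [R[i]] is real, so the Archimedean property is inherited from [R]. *)
Lemma complex_archimedean (R : realType) (x : R[i]) :
  0 < x -> exists n : nat, x < n%:R.
Proof.
move=> x0; have /complex_realP[y xy] := gtr0_real x0.
exists (Num.bound y); move: x0; rewrite xy -(rmorph_nat (real_complex R)) !ltcR.
by move=> y0; rewrite archi_boundP// ltW.
Qed.

Lemma cvg_invS_dnbhs (K : numFieldType) :
  (forall x : K, 0 < x -> exists n : nat, x < n%:R) ->
  (fun n => n.+1%:R^-1 : K) @ \oo --> 0^'.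
Proof.
move=> archi P P0.
have u0 : (fun n => n.+1%:R^-1 : K) @ \oo --> 0.
  apply/cvgrPdist_lt => e e0.
  have /archi[m em] : 0 < e^-1 by rewrite invr_gt0.
  near=> n; rewrite sub0r normrN normfV ger0_norm// invf_plt ?posrE//.
  by rewrite (lt_le_trans em)// ler_nat leqW//; near: n; exact: nbhs_infty_ge.
suff: \forall n \near \oo, P (n.+1%:R^-1) by [].
have : \forall n \near \oo, (n.+1%:R^-1 : K) != 0 -> P (n.+1%:R^-1).
  exact: (u0 _ P0).
apply: filterS => n; apply.
by rewrite invr_eq0 pnatr_eq0.
Unshelve. all: by end_near. Qed.

Theorem theorem1 (R : realType) (t : nat) (t_gt0 : (0 < t)%N)
    (Omega : set R[i]) (Omega_nbhs0 : nbhs (0 : R[i]^o) Omega) :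
  ~ exists (f : R[i] -> R[i]) (a : nat -> R[i]),
      [/\ has_power_series f 0 a,
          analytic_on Omega f &
          transcendental f] /\
      [/\ forall k : nat, (k <= t)%N -> rationals R[i] (a k),
          f @` (rationals R[i] `&` Omega) `<=` rationals R[i] &
          exists (C : R) (q0 : int), 0 < C /\
            forall r s : rat, Omega (ratr r) -> q0 <= denq r ->
              f (ratr r) = ratr s ->
              (denq s)%:~R <= C * (denq r)%:~R `^ (t%:R / 2)].
Proof.
move=> [f [a [[fa _ ftr] [aQ fQ [C [q0 [_ denC]]]]]]]; apply: ftr.
(* The value 0 beyond [t] is a dummy: only [b 0], ..., [b t] enter the polynomial to be
   approximated. *)
have /choice[b ba] : forall k, exists x : rat, (k <= t)%N -> ratr x = a k.
  move=> k; case: (leqP k t) => kt; last by exists 0.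
  by have [x _ xa] := aQ k kt; exists x.
have [A [B [A0 sA sB AB]]] :=
  pade_approximant (\poly_(k < t.+1) b k) t./2 (uphalf t).
have mn : (t./2 + uphalf t)%N = t by lia.
pose A' : {poly R[i]} := map_poly ratr A; pose B' : {poly R[i]} := map_poly ratr B.
pose g z := A'.[z] * f z - B'.[z].
pose c k := \sum_(j < k.+1) A'`_j * a (k - j)%N - B'`_k.
have gc : has_power_series g 0 c.
  exact: has_power_series_polyMB.
(* Up to degree [t], the product of [A'] with the series only involves [a 0], ..., [a t], so the
   truncated series may replace it. *)
have c0 k : (k < t.+1)%N -> c k = 0.
  rewrite ltnS => kt; have := AB k; rewrite mn => /(_ kt) /(congr1 (@ratr R[i])).
  rewrite rmorph0 => <-; rewrite coefB rmorphB /= coefM rmorph_sum /c.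
  rewrite /B' coef_map; congr (_ - _); apply: eq_bigr => j _.
  by rewrite rmorphM /A' coef_map coef_poly ltnS (leq_trans (leq_subr _ _))//= ba// (leq_trans (leq_subr _ _)).
have [M M0 gM] := has_power_series_order gc c0.
(* Both degrees are now bounded by [uphalf t], the exponent of [q] that clears [A] and [B]
   together. *)
have un : ((uphalf t).*2 <= t.+1)%N by lia.
have {}sA : (size A <= (uphalf t).+1)%N by apply: leq_trans sA _; lia.
(* As [M] is positive in [R[i]], it equals its real part, which carries the estimate over to [R]. *)
have [q1 vanish] := pade_values_eq (complex.Re M) C un sA sB.
suff gu0 : \forall q \near \oo, g (q.+1%:R^-1) = 0.
  have g0 := power_series_eq0 gc
    (power_series_coef_eq0 gc (cvg_invS_dnbhs (@complex_archimedean R)) gu0).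
  by apply: rational_algebraic g0; rewrite map_poly_eq0.
near=> q.
have Om : Omega (q.+1%:R^-1).
  near: q; exact: (cvg_invS_dnbhs (@complex_archimedean R) (nbhs_dnbhs Omega_nbhs0)).
have gb : `|g (q.+1%:R^-1)| <= M * `|q.+1%:R^-1| ^+ t.+1.
  near: q; exact: (cvg_invS_dnbhs (@complex_archimedean R) gM).
have uE : q.+1%:R^-1 = ratr (q.+1%:R^-1) :> R[i] by rewrite fmorphV rmorph_nat.
have [s _ sf] : rationals R[i] (f (q.+1%:R^-1)).
  by apply: fQ; exists (q.+1%:R^-1) => //; split => //; exists (q.+1%:R^-1).
have hE (p : {poly rat}) : (map_poly ratr p).[q.+1%:R^-1] = ratr p.[q.+1%:R^-1] :> R[i].
  by rewrite uE horner_map.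
have gE : g (q.+1%:R^-1) = ratr (A.[q.+1%:R^-1] * s - B.[q.+1%:R^-1]).
  by rewrite /g !hE -sf rmorphB rmorphM.
have dq : denq (q.+1%:R^-1) = q.+1.
  by rewrite -[q.+1%:R]/(q.+1%:~R) denqVz.
rewrite gE (vanish q.+1 s) ?subrr ?rmorph0//.
- by near: q; exists q1 => // k /=; rewrite ltnS.
- rewrite (le_trans (denC (q.+1%:R^-1) s _ _ _))// ?dq//.
  + by rewrite -uE.
  (* The integer [q0] may be negative; its absolute value provides a natural threshold. *)
  + rewrite (le_trans (lez_abs q0))// lez_nat leqW//; near: q.
    exact: nbhs_infty_ge.
  + by rewrite -uE.
- rewrite -lecR (fmorph_rat (real_complex R)) ratr_norm -gE.
  rewrite [leRHS](rmorphM (real_complex R)) (rmorphXn (real_complex R)).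
  rewrite (fmorphV (real_complex R)) (rmorph_nat (real_complex R)).
  rewrite /= (RRe_real (gtr0_real M0)).
  by move: gb; rewrite [`|_^-1|]ger0_norm// invr_ge0 ler0n.
Unshelve. all: by end_near. Qed.
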